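(* Let $d\ge 2$ and let $\nu=(\nu_1,\dots,\nu_d)$ be probability distributions on $\mathbb{Z}_+^d$ forming the progeny distribution of a $d$-type branching process $\mathbf Z$ which is irreducible, non-degenerated, and critical or subcritical. For $i\in[d]$ let $O_i$ be the total number of individuals of type $i$ born up to the extinction time $T$, and for $i\neq j$ let $A_{ij}$ be the total number of individuals of type $j$ whose parent is of type $i$, up to time $T$. Then for all integers $r_i,n_i,k_{ij}$, $i,j\in[d]$, such that $r_i\ge 0$, $r_1+\dots+r_d\ge 1$, $k_{ij}\ge 0$ for $i\ne j$, $-k_{jj}=r_j+\sum_{i\ne j}k_{ij}$ for all $j$, and $n_i\ge -k_{ii}$ for all $i$, we have $$\mathbb{P}_{\mathrm r}\Big(O_1=n_1,\dots,O_d=n_d,\ A_{ij}=k_{ij},\ i,j\in[d],\ i\neq j\Big)=\frac{\det(K)}{\bar n_1\bar n_2\cdots\bar n_d}\prod_{i=1}^d\nu_i^{*n_i}\big(k_{i1},\dots,k_{i(i-1)},n_i+k_{ii},k_{i(i+1)},\dots,k_{id}\big),$$ where $\mathrm r=(r_1,\dots,r_d)$, $\nu_i^{*0}=\delta_0$, $\bar n_i=n_i\vee 1$, and $K$ is the matrix $(-k_{ij})_{i,j\in[d]}$ from which the line $i$ and the column $i$ have been removed for every $i$ such that $n_i=0$.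
   Context: $[d]=\{1,\dots,d\}$, $\mathbb{Z}_+=\{0,1,2,\dots\}$. A $d$-type branching process with progeny distribution $\nu=(\nu_1,\dots,\nu_d)$ is the $\mathbb{Z}_+^d$-valued Markov chain $\mathbf Z_n=(Z^{(1)}_n,\dots,Z^{(d)}_n)$ with transition probabilities $P(\mathbf Z_{n+1}=\mathrm k\mid \mathbf Z_n=(r_1,\dots,r_d))=\nu_1^{*r_1}*\dots*\nu_d^{*r_d}(\mathrm k)$, where $\nu^{*r}$ is the $r$-fold convolution power ($\nu^{*0}=\delta_0$); $Z^{(i)}_n$ is the number of individuals of type $i$ in generation $n$, each individual of type $i$ independently having a random vector of children (numbers of children of each type) with law $\nu_i$. The process is realized as the genealogical forest of these individuals, so that the type of each individual's parent is defined. $\mathbb{P}_{\mathrm r}$ denotes the law when $\mathbf Z_0=\mathrm r$. The mean matrix is $M=(m_{ij})$ with $m_{ij}=\sum_{\mathbf z\in\mathbb{Z}_+^d} z_j\nu_i(\mathbf z)$; irreducible means $M$ is irreducible, and then its Perron–Frobenius eigenvalue $\rho$ satisfies $\rho\le 1$ (critical: $\rho=1$, subcritical: $\rho<1$). Non-degenerated means it is not the case that every individual has exactly one child almost surely. Under these assumptions the extinction time $T=\inf\{n:\mathbf Z_n=0\}$ is a.s. finite, and $O_i=\sum_{n\ge 0}Z^{(i)}_n$. *)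

(* Defs.v *)
From HB Require Import structures.
From mathcomp Require Import all_boot all_order all_algebra.
From mathcomp Require Import all_classical all_reals all_analysis.
From mathcomp Require Import complex.

Set Implicit Arguments.
Unset Strict Implicit.
Unset Printing Implicit Defensive.

Import Order.TTheory GRing.Theory Num.Theory.
Local Open Scope ring_scope.
Local Open Scope classical_set_scope.

Definition vec (d : nat) := {ffun 'I_d -> nat}.

Definition vbound d (k : vec d) : nat := \max_(j < d) k j.

Fixpoint conv_pow (R : numDomainType) d (nu : vec d -> R) (m : nat) (k : vec d)
  {struct m} : R :=
  match m with
  | 0 => if [forall j, k j == 0%N] then 1 else 0
  | m'.+1 =>
      \sum_(a : {ffun 'I_d -> 'I_(vbound k).+1} | [forall j, (a j <= k j)%N])
        conv_pow nu m' [ffun j => nat_of_ord (a j)] *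
        nu [ffun j => (k j - a j)%N]
  end.

Definition is_prob_vec (R : realType) d (p : vec d -> R) : Prop :=
  (forall z, 0 <= p z) /\ (\esum_(z in [set: vec d]) (p z)%:E = 1%E).

Definition mean_e (R : realType) d (nu : 'I_d -> vec d -> R) (i j : 'I_d)
  : \bar R := \esum_(z in [set: vec d]) ((z j)%:R * nu i z)%:E.

Definition finite_means (R : realType) d (nu : 'I_d -> vec d -> R) : Prop :=
  forall i j, (mean_e nu i j < +oo)%E.

Definition mean_matrix (R : realType) d (nu : 'I_d -> vec d -> R) : 'M[R]_d :=
  \matrix_(i, j) fine (mean_e nu i j).

Definition irreducible_mx (R : realType) d (M : 'M[R]_d) : Prop :=
  forall i j : 'I_d, exists n : nat, 0 < (M ^+ n.+1) i j.

Definition spectral_radius_le1 (R : realType) d (M : 'M[R]_d) : Prop :=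
  forall lambda : R[i],
    root (map_poly (fun x : R => (x%:C)%C) (char_poly M)) lambda ->
    `|lambda| <= 1.

Definition degenerate (R : realType) d (nu : 'I_d -> vec d -> R) : Prop :=
  forall i, (\esum_(z in [set z : vec d | (\sum_(j < d) z j)%N = 1%N]) (nu i z)%:E
             = 1)%E.

(** Progeny matrices per generation: [C i] = total children vector of the
    type-i individuals of the generation. *)
Definition gmat (d : nat) := {ffun 'I_d -> vec d}.

(** Next generation: Z_{t+1}(j) = sum_i C_t(i)(j). *)
Definition colsum d (C : gmat d) : vec d := [ffun j => (\sum_(i < d) C i j)%N].

(** Z_t along a trajectory [cs] = [C_0; ...; C_{T-1}] started at r. *)
Definition Zt d (r : vec d) (cs : seq (gmat d)) (t : nat) : vec d :=
  nth r (r :: map (@colsum d) cs) t.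

Definition vzero d (z : vec d) : bool := [forall j, z j == 0%N].

Definition extinct_path d (r : vec d) (cs : seq (gmat d)) : bool :=
  vzero (Zt r cs (size cs)) && [forall t : 'I_(size cs), ~~ vzero (Zt r cs t)].

(** Probability of the trajectory under the branching mechanism: given
    Z_t, the type-i individuals' children vectors sum to C_t(i), which has
    law nu_i^{*Z_t(i)}, independently over i. *)
Definition path_weight (R : realType) d (nu : 'I_d -> vec d -> R)
  (r : vec d) (cs : seq (gmat d)) : R :=
  \prod_(t < size cs) \prod_(i < d)
     conv_pow (nu i) (Zt r cs t i) (nth [ffun _ => [ffun _ => 0%N]] cs t i).

Definition O_tot d (r : vec d) (cs : seq (gmat d)) (j : 'I_d) : nat :=
  (\sum_(t < (size cs).+1) Zt r cs t j)%N.

Definition A_tot d (cs : seq (gmat d)) (i j : 'I_d) : nat :=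
  (\sum_(t < size cs) nth [ffun _ => [ffun _ => 0%N]] cs t i j)%N.

(** P_r(O_1=n_1,...,O_d=n_d, A_ij=k_ij for i<>j), computed as the sum of the
    probabilities of all finite trajectories dying out with these totals
    (on {T = oo} some O_j is infinite, so this is the whole event). *)
Definition prob_OA (R : realType) d (nu : 'I_d -> vec d -> R) (r : vec d)
  (n : 'I_d -> int) (k : 'I_d -> 'I_d -> int) : \bar R :=
  \esum_(cs in [set cs : seq (gmat d) |
          [/\ extinct_path r cs,
              forall j, (O_tot r cs j)%:Z = n j &
              forall i j, i != j -> (A_tot cs i j)%:Z = k i j]])
     (path_weight nu r cs)%:E.

Definition detK d (n : 'I_d -> int) (k : 'I_d -> 'I_d -> int) : int :=
  let S := [set i : 'I_d | n i != 0] in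
  \det (\matrix_(a < #|S|, b < #|S|) (- k (enum_val a) (enum_val b))).

(* Main.v *)
(** Let [A_ij] be the total number of children of type [j] of the individuals of
    type [i] and [n = r + colsum A]. The probability that the process dies out with
    totals [A] is claimed to be [\det (1 - (A_ij / n_i)) * \prod_i nu_i^{*n_i}(A_i)],
    and this is shown by induction on [\sum_i n_i], conditioning on the first
    generation. If [C] are the children of the initial individuals, what remains is a
    forest with totals [A - C], in which the number of individuals of type [i] is
    [n_i - r_i], whatever [C] is. Given the totals the rows [C_i] are independent, and
    the determinant is multilinear in the rows, so that each row can be averaged
    separately; by exchangeability of the [n_i] individuals of type [i], [C_i] has mean
    [(r_i / n_i) A_i], which turns row [i] for [(n - r, A - C)] into row [i] for
    [(n, A)]. *)
Require Import Defs.
From HB Require Import structures.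
From mathcomp Require Import all_boot all_order all_algebra.
From mathcomp Require Import all_classical all_reals all_analysis.
From mathcomp Require Import complex.
From mathcomp Require Import perm zify ring.
Import Order.TTheory GRing.Theory Num.Theory.
Local Open Scope ring_scope.

Set Implicit Arguments.
Unset Strict Implicit.
Unset Printing Implicit Defensive.

(** * Convolution powers *)

Definition vle d (a k : vec d) : bool := [forall j, (a j <= k j)%N].
Definition vsub d (k a : vec d) : vec d := [ffun j => (k j - a j)%N].
Definition vadd d (k a : vec d) : vec d := [ffun j => (k j + a j)%N].

Lemma vleP d (a k : vec d) : reflect (forall j, (a j <= k j)%N) (vle a k).
Proof. exact: forallP. Qed.

Lemma vsub_le d (k a : vec d) : vle (vsub k a) k.
Proof. by apply/vleP => j; rewrite ffunE leq_subr. Qed.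

Lemma vsubK d (k a : vec d) : vle a k -> vsub k (vsub k a) = a.
Proof. by move=> /vleP le; apply/ffunP => j; rewrite !ffunE subKn. Qed.

Lemma vle_trans d (a b c : vec d) : vle a b -> vle b c -> vle a c.
Proof.
by move=> /vleP ab /vleP bc; apply/vleP => j; apply: leq_trans (ab j) (bc j).
Qed.

Definition of_box d B (a : {ffun 'I_d -> 'I_B.+1}) : vec d :=
  [ffun j => nat_of_ord (a j)].

Lemma of_box_inj d B : injective (@of_box d B).
Proof.
by move=> a b /ffunP e; apply/ffunP => j; apply: val_inj; move: (e j); rewrite !ffunE.
Qed.

(** The bound [B] is left free so that vectors with different [vbound] can share one finite index
    type. Lists of plain vectors keep the type of the index independent of [k]. *)
Definition box_in d B (k : vec d) : seq (vec d) :=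
  [seq of_box a | a <- enum [pred a : {ffun 'I_d -> 'I_B.+1} | vle (of_box a) k]].

Definition box d (k : vec d) : seq (vec d) := box_in (vbound k) k.

Lemma box_in_uniq d B (k : vec d) : uniq (box_in B k).
Proof. by rewrite map_inj_uniq ?enum_uniq //; apply: of_box_inj. Qed.

Lemma mem_box_in d B (k a : vec d) :
  (vbound k <= B)%N -> (a \in box_in B k) = vle a k.
Proof.
move=> kB; apply/mapP/idP => [[b]|ak]; first by rewrite mem_enum inE => ? ->.
have e : of_box [ffun j => inord (a j) : 'I_B.+1] = a.
  apply/ffunP => j; rewrite !ffunE inordK // ltnS (leq_trans _ kB) //.
  by rewrite (leq_trans (forallP ak j)) // /vbound; apply: (leq_bigmax j).
by exists [ffun j => inord (a j) : 'I_B.+1]; rewrite ?mem_enum ?inE e.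
Qed.

Lemma box_uniq d (k : vec d) : uniq (box k).
Proof. exact: box_in_uniq. Qed.

Lemma mem_box d (k a : vec d) : (a \in box k) = vle a k.
Proof. exact: mem_box_in. Qed.

Lemma perm_box_in d B (k : vec d) :
  (vbound k <= B)%N -> perm_eq (box k) (box_in B k).
Proof.
move=> kB; apply: uniq_perm (box_uniq _) (box_in_uniq _ _) _ => a.
by rewrite mem_box mem_box_in.
Qed.

Lemma perm_box_vsub d (k : vec d) : perm_eq (box k) [seq vsub k a | a <- box k].
Proof.
apply: uniq_perm; first exact: box_uniq.
  rewrite map_inj_in_uniq ?box_uniq // => a b; rewrite !mem_box => ak bk e.
  by rewrite -(vsubK ak) e vsubK.
move=> a; rewrite mem_box; apply/idP/mapP => [ak|[b _ ->]]; last exact: vsub_le.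
by exists (vsub k a); rewrite ?mem_box ?vsub_le ?vsubK.
Qed.

Lemma perm_box_shift d (k b : vec d) : vle b k ->
  perm_eq [seq a <- box k | vle b a] [seq vadd b c | c <- box (vsub k b)].
Proof.
move=> /vleP bk; apply: uniq_perm; first by rewrite filter_uniq ?box_uniq.
  rewrite map_inj_uniq ?box_uniq // => c c' /ffunP e; apply/ffunP => j.
  by move: (e j); rewrite !ffunE => /addnI.
move=> a; rewrite mem_filter mem_box; apply/andP/mapP => [[/vleP ba /vleP ak]|].
  exists (vsub a b); last by apply/ffunP => j; rewrite !ffunE subnKC.
  by rewrite mem_box; apply/vleP => j; rewrite !ffunE leq_sub2r.
case=> c; rewrite mem_box => /vleP ck ->; split; apply/vleP => j.
  by rewrite ffunE leq_addr.
by move: (ck j); rewrite !ffunE leq_subRL.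
Qed.

Definition vconv (R : pzSemiRingType) d (f g : vec d -> R) (k : vec d) : R :=
  \sum_(a <- box k) f a * g (vsub k a).

Lemma vconvC (R : comPzSemiRingType) d (f g : vec d -> R) : vconv f g =1 vconv g f.
Proof.
move=> k; rewrite /vconv (perm_big _ (perm_box_vsub k)) big_map.
rewrite !big_seq; apply: eq_bigr => a; rewrite mem_box => ak.
by rewrite vsubK // mulrC.
Qed.

(** Both sides sum over chains [b <= a <= k]; after exchanging the sums, the substitution
    [a = b + c] of [perm_box_shift] gives the right-hand side. *)
Lemma vconvA (R : pzSemiRingType) d (f g h : vec d -> R) :
  vconv (vconv f g) h =1 vconv f (vconv g h).
Proof.
move=> k; rewrite /vconv.
transitivity (\sum_(a <- box k) \sum_(b <- box k | vle b a)
    f b * g (vsub a b) * h (vsub k a)).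
  rewrite !big_seq; apply: eq_bigr => a; rewrite mem_box => ak.
  rewrite big_distrl /= -[RHS]big_filter; apply: perm_big.
  apply: uniq_perm; rewrite ?box_uniq ?filter_uniq ?box_uniq // => b.
  rewrite mem_filter !mem_box; case: (boolP (vle b a)) => //= ba.
  by rewrite (vle_trans ba ak).
rewrite (exchange_big_dep xpredT) //= !big_seq; apply: eq_bigr => b.
rewrite mem_box => bk; rewrite -big_filter (perm_big _ (perm_box_shift bk)) big_map.
rewrite big_distrr /=; apply: eq_bigr => c _; rewrite mulrA; congr (_ * g _ * h _).
  by apply/ffunP => j; rewrite !ffunE addKn.
by apply/ffunP => j; rewrite !ffunE subnDA.
Qed.

Lemma eq_vconv (R : pzSemiRingType) d (f f' g g' : vec d -> R) :
  f =1 f' -> g =1 g' -> vconv f g =1 vconv f' g'.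
Proof. by move=> ff gg k; apply: eq_bigr => a _; rewrite ff gg. Qed.

Lemma conv_powS (R : numDomainType) d (nu : vec d -> R) m k :
  conv_pow nu m.+1 k = vconv (conv_pow nu m) nu k.
Proof.
rewrite /vconv /box /box_in big_map big_enum_cond /=.
apply: eq_big => [a|a _]; last by congr (_ * nu _); apply/ffunP => j; rewrite !ffunE.
by rewrite inE andbT; apply: eq_forallb => j; rewrite ffunE.
Qed.

Lemma conv_pow0 (R : numDomainType) d (nu : vec d -> R) k :
  conv_pow nu 0 k = (vzero k)%:R.
Proof. by rewrite /= /vzero; case: ifP. Qed.

Lemma vconv_dirac (R : numDomainType) d (f nu : vec d -> R) :
  vconv f (conv_pow nu 0) =1 f.
Proof.
move=> k; have kk : k \in box k by rewrite mem_box; apply/vleP.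
rewrite /vconv (bigD1_seq k) ?box_uniq //=.
rewrite big1_seq => [|a /andP[ak]].
  by rewrite ifT ?mulr1 ?addr0 //; apply/forallP => j; rewrite ffunE subnn.
rewrite mem_box => /vleP le; rewrite ifF ?mulr0 //.
apply: contraNF ak => /forallP e; apply/eqP/ffunP => j.
by apply/eqP; rewrite eqn_leq le /= -subn_eq0; move: (e j); rewrite ffunE.
Qed.

Lemma conv_powD (R : numDomainType) d (nu : vec d -> R) r m k :
  conv_pow nu (r + m) k = vconv (conv_pow nu r) (conv_pow nu m) k.
Proof.
elim: m k => [|m IH] k; first by rewrite addn0 vconv_dirac.
rewrite addnS conv_powS (eq_vconv IH (frefl _)) vconvA.
by apply: eq_vconv => // a; rewrite conv_powS.
Qed.

(* Multiplication by a coordinate is a derivation of the convolution algebra, so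
   [D (nu^r) * nu^m] is [r] times a quantity depending on [r + m] only. *)
Definition coord_deriv (R : pzSemiRingType) d (j : 'I_d) (f : vec d -> R)
    (k : vec d) : R :=
  (k j)%:R * f k.

Lemma coord_deriv_vconv (R : comPzSemiRingType) d j (f g : vec d -> R) k :
  coord_deriv j (vconv f g) k =
  vconv (coord_deriv j f) g k + vconv f (coord_deriv j g) k.
Proof.
rewrite /vconv -big_split /coord_deriv big_distrr /= !big_seq.
apply: eq_bigr => a; rewrite mem_box => /vleP ak.
have -> : (k j)%:R = (a j)%:R + (vsub k a j)%:R :> R.
  by rewrite ffunE -natrD subnKC.
by rewrite mulrDl mulrA [X in _ + X = _]mulrCA.
Qed.

(** The power rule of a derivation, by induction from the Leibniz rule; commutativity moves the
    differentiated factor to the end. *)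
Lemma coord_deriv_pow (R : numDomainType) d j (nu : vec d -> R) r k :
  coord_deriv j (conv_pow nu r.+1) k =
  r.+1%:R * vconv (conv_pow nu r) (coord_deriv j nu) k.
Proof.
have congD f g x : f =1 g -> @coord_deriv R d j f x = coord_deriv j g x.
  by rewrite /coord_deriv => ->.
elim: r k => [|r IH] k.
  rewrite mul1r (congD _ _ _ (conv_powS nu 0)) coord_deriv_vconv.
  rewrite -[RHS]add0r; congr (_ + _); rewrite /vconv big1 // => a _.
  rewrite /coord_deriv conv_pow0; case: (boolP (vzero a)) => [/forallP/(_ j)/eqP ->|_].
    by rewrite !mul0r.
  by rewrite mulr0 mul0r.
rewrite (congD _ _ _ (conv_powS nu r.+1)) coord_deriv_vconv.
rewrite -[X in _ = X%:R * _]addn1 natrD mulrDl mul1r; congr (_ + _).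
have -> : vconv (coord_deriv j (conv_pow nu r.+1)) nu k =
    r.+1%:R * vconv (vconv (conv_pow nu r) (coord_deriv j nu)) nu k.
  rewrite /vconv big_distrr /=; apply: eq_bigr => a _.
  by rewrite IH -mulrA.
congr (_ * _); rewrite vconvA (eq_vconv (frefl _) (vconvC _ _)) -vconvA.
by apply: eq_vconv => // a; rewrite conv_powS.
Qed.

(** Exchangeability: given that [r + m] individuals have [k] children in total, the first [r] of
    them have on average the share [r / (r + m)] of [k j]. By the power rule both sides are
    multiples of [nu^{r+m-1}] convolved with [coord_deriv j nu]. Without division, the case
    [r + m = 0] is included. *)
Lemma coord_mean_vconv (R : numDomainType) d j (nu : vec d -> R) r m k :
  (r + m)%:R * vconv (coord_deriv j (conv_pow nu r)) (conv_pow nu m) k =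
  r%:R * (k j)%:R * conv_pow nu (r + m) k.
Proof.
case: r => [|r].
  rewrite !mul0r /vconv big1 ?mulr0 // => a _; rewrite /coord_deriv conv_pow0.
  case: (boolP (vzero a)) => [/forallP/(_ j)/eqP ->|_]; first by rewrite !mul0r.
  by rewrite mulr0 mul0r.
rewrite -mulrA -/(coord_deriv j (conv_pow nu (r.+1 + m)) k) addSn coord_deriv_pow.
rewrite mulrCA; congr (_ * _).
have -> : vconv (coord_deriv j (conv_pow nu r.+1)) (conv_pow nu m) k =
    r.+1%:R * vconv (vconv (conv_pow nu r) (coord_deriv j nu)) (conv_pow nu m) k.
  rewrite /vconv big_distrr /=; apply: eq_bigr => a _.
  by rewrite coord_deriv_pow -mulrA.
congr (_ * _); rewrite vconvA (eq_vconv (frefl _) (vconvC _ _)) -vconvA.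
by apply: eq_vconv => // a; rewrite conv_powD.
Qed.

(** * Determinants *)

(** Sylvester's identity: multiplying [Z] by the same unipotent block matrix on the right or on the
    left computes [\det Z] in two ways. *)
Lemma det_add1_mulC (R : comPzRingType) m n (X : 'M[R]_(m, n)) (Y : 'M[R]_(n, m)) :
  \det (1%:M + X *m Y) = \det (1%:M + Y *m X).
Proof.
pose Z := block_mx 1%:M (- X) Y 1%:M.
have e1 : Z *m block_mx 1%:M X 0 1%:M = block_mx 1%:M 0 Y (1%:M + Y *m X).
  by rewrite mulmx_block !mulmx1 !mulmx0 !mul1mx !addr0 subrr addrC.
have e2 : block_mx 1%:M X 0 1%:M *m Z = block_mx (1%:M + X *m Y) 0 Y 1%:M.
  by rewrite mulmx_block !mulmx1 !mul1mx !mul0mx !add0r addNr.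
have := congr1 determinant e1; have := congr1 determinant e2.
by rewrite !det_mulmx !det_lblock !det_ublock !det1 !mul1r !mulr1 => <- <-.
Qed.

(** The columns of [Q - 1] outside [A] vanish, so [Q - 1] factors through the matrix [P] that
    selects the indices in [A]. Exchanging the factors by Sylvester's identity leaves a determinant
    of size [#|A|]. *)
Lemma det_minor_unit_cols (R : comPzRingType) d (A : {pred 'I_d}) (Q : 'M[R]_d) :
  (forall i j, i \notin A -> Q j i = (j == i)%:R) ->
  \det Q = \det (\matrix_(a < #|A|, b < #|A|) Q (enum_val a) (enum_val b)).
Proof.
move=> QA; pose P : 'M[R]_(#|A|, d) := \matrix_(a, i) (enum_val a == i)%:R.
have PM p (N : 'M[R]_(d, p)) : P *m N = \matrix_(a, j) N (enum_val a) j.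
  apply/matrixP => a j; rewrite !mxE (bigD1 (enum_val a)) //= big1 => [|i ni].
    by rewrite mxE eqxx mul1r addr0.
  by rewrite mxE eq_sym (negbTE ni) mul0r.
have MPt p (N : 'M[R]_(p, d)) : N *m P^T = \matrix_(j, a) N j (enum_val a).
  apply/matrixP => j a; rewrite !mxE (bigD1 (enum_val a)) //= big1 => [|i ni].
    by rewrite !mxE eqxx mulr1 addr0.
  by rewrite !mxE eq_sym (negbTE ni) mulr0.
have QP : (Q - 1%:M) *m P^T *m P = Q - 1%:M.
  rewrite MPt; apply/matrixP => i j; rewrite !mxE.
  case: (boolP (j \in A)) => jA; last first.
    rewrite QA // subrr big1 // => a _; rewrite !mxE.
    case: (enum_val a =P j) => [ej|_]; last by rewrite mulr0.
    by case/negP: jA; rewrite -ej enum_valP.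
  rewrite (bigD1 (enum_rank_in jA j)) //= big1 => [|a na].
    by rewrite !mxE enum_rankK_in // eqxx mulr1 addr0.
  rewrite !mxE; case: (enum_val a =P j) => [ej|_]; last by rewrite mulr0.
  by case/eqP: na; apply: enum_val_inj; rewrite enum_rankK_in // ej.
rewrite -[Q in LHS](subrKC 1%:M) -QP det_add1_mulC; congr (\det _).
rewrite mulmxA PM MPt; apply/matrixP => a b; rewrite !mxE.
by rewrite (inj_eq enum_val_inj) subrKC.
Qed.

(** * Conditioning on the first generation *)

Definition gle d (C A : gmat d) : bool := [forall i, vle (C i) (A i)].
Definition gsub d (A C : gmat d) : gmat d := [ffun i => vsub (A i) (C i)].
Definition gadd d (A C : gmat d) : gmat d := [ffun i => vadd (A i) (C i)].
Definition gzero d : gmat d := [ffun _ => [ffun _ => 0%N]].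

Lemma gleP d (C A : gmat d) : reflect (forall i j, (C i j <= A i j)%N) (gle C A).
Proof.
apply: (iffP forallP) => le i; first exact/vleP.
by apply/vleP => j; apply: le.
Qed.

Definition of_gbox d B (C : {ffun 'I_d -> {ffun 'I_d -> 'I_B.+1}}) : gmat d :=
  [ffun i => of_box (C i)].

Definition gbound d (A : gmat d) : nat := (\max_(i < d) vbound (A i))%N.

Definition gbox d (A : gmat d) : seq (gmat d) :=
  [seq of_gbox C | C <- enum [pred C : {ffun 'I_d -> {ffun 'I_d -> 'I_(gbound A).+1}}
                              | gle (of_gbox C) A]].

Lemma gbox_uniq d (A : gmat d) : uniq (gbox A).
Proof.
rewrite map_inj_uniq ?enum_uniq // => C C' /ffunP e; apply/ffunP => i.
by apply: of_box_inj; move: (e i); rewrite !ffunE.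
Qed.

Lemma vbound_le_gbound d (A : gmat d) i : (vbound (A i) <= gbound A)%N.
Proof. exact: (leq_bigmax i). Qed.

Lemma mem_gbox d (A C : gmat d) : (C \in gbox A) = gle C A.
Proof.
apply/mapP/idP => [[b]|CA]; first by rewrite mem_enum inE => ? ->.
have e : of_gbox [ffun i => [ffun j => inord (C i j) : 'I_(gbound A).+1]] = C.
  apply/ffunP => i; apply/ffunP => j; rewrite !ffunE inordK // ltnS.
  apply: leq_trans (vbound_le_gbound A i); apply: leq_trans (gleP _ _ CA i j) _.
  exact: (leq_bigmax j).
by exists [ffun i => [ffun j => inord (C i j)]]; rewrite ?mem_enum ?inE e.
Qed.

(** Distributivity, with all rows enumerated under the common bound [gbound A]. This is where the
    independence of the rows enters. *)
Lemma sum_gbox_prod (R : comPzSemiRingType) d (A : gmat d) (F : 'I_d -> vec d -> R) :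
  \sum_(C <- gbox A) \prod_(i < d) F i (C i) =
  \prod_(i < d) \sum_(a <- box (A i)) F i a.
Proof.
under [RHS]eq_bigr => i _ do
  rewrite (perm_big _ (perm_box_in (vbound_le_gbound A i))) big_map big_enum_cond.
rewrite bigA_distr_big_dep big_map big_enum_cond /=.
apply: eq_big => [C|C _]; last by apply: eq_bigr => i _; rewrite ffunE.
rewrite inE andbT; apply: eq_forallb => i. by rewrite ffunE /in_mem /= andbT.
Qed.

Lemma colsum_gsub d (A C : gmat d) : gle C A ->
  vadd (colsum C) (colsum (gsub A C)) = colsum A.
Proof.
move=> /gleP CA; apply/ffunP => j; rewrite !ffunE -big_split /=.
by apply: eq_bigr => i _; rewrite !ffunE subnKC.
Qed.

(* The matrix [(n_i [i = j] - A_ij)] with row [i] divided by [n_i]. When [n_i = 0] the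
   [i]-th column of [A] vanishes, so that column [i] is a unit vector and the index [i]
   drops out of the determinant. *)
Definition forest_mx (R : realType) d (n : vec d) (A : gmat d) : 'M[R]_d :=
  \matrix_(i, j) ((i == j)%:R - (A i j)%:R / (maxn (n i) 1)%:R).

Definition forest_weight (R : realType) d (nu : 'I_d -> vec d -> R) (r : vec d)
    (A : gmat d) : R :=
  let n := vadd r (colsum A) in
  \det (forest_mx R n A) * \prod_(i < d) conv_pow (nu i) (n i) (A i).

Lemma sum_forest_row (R : realType) d (nu : vec d -> R) (r m : nat) (k : vec d)
    (e : R) j :
  m != 0%N ->
  \sum_(c <- box k) conv_pow nu r c *
     (conv_pow nu m (vsub k c) * (e - (vsub k c j)%:R / (maxn m 1)%:R)) =
  conv_pow nu (r + m) k * (e - (k j)%:R / (maxn (r + m) 1)%:R).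
Proof.
move=> m0; have -> : maxn m 1 = m by apply/maxn_idPl; rewrite lt0n.
have -> : maxn (r + m) 1 = (r + m)%N by apply/maxn_idPl; lia.
transitivity (e * vconv (conv_pow nu r) (conv_pow nu m) k
    - vconv (conv_pow nu r) (coord_deriv j (conv_pow nu m)) k / m%:R).
  rewrite /vconv big_distrr big_distrl -sumrB /=; apply: eq_bigr => c _.
  by rewrite /coord_deriv; ring.
have mR : m%:R != 0 :> R by rewrite pnatr_eq0.
have nR : (r + m)%:R != 0 :> R by rewrite pnatr_eq0; lia.
(* The mean is that of the [m] remaining individuals, so [r] and [m] change roles; their share
   [m / (r + m)] turns the divisor [m] into [r + m]. *)
have := coord_mean_vconv j nu m r k; rewrite addnC vconvC -conv_powD.
move: (conv_pow nu (r + m) k) (vconv _ _ k) nR => y x nR.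
move=> /(canRL (mulKf nR)) ->; field.
by rewrite -natrD nR mR.
Qed.

(** Only [c = k] contributes, and there the quotient is zero. The result has the form of
    [sum_forest_row] when [k j = 0], as happens on the diagonal for a type that no one has as a
    child. *)
Lemma sum_forest_row0 (R : realType) d (nu : vec d -> R) (r : nat) (k : vec d)
    (e : R) j :
  \sum_(c <- box k) conv_pow nu r c *
     (conv_pow nu 0 (vsub k c) * (e - (vsub k c j)%:R / (maxn 0 1)%:R)) =
  conv_pow nu r k * e.
Proof.
rewrite -[in RHS](vconv_dirac (conv_pow nu r) nu) /vconv big_distrl.
apply: eq_bigr => c _; rewrite conv_pow0.
case: (boolP (vzero _)) => [/forallP/(_ j)/eqP ->|_].
  by rewrite mul0r subr0 mulrA.
by rewrite /= mulr0n mul0r !mulr0 mul0r.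
Qed.

Lemma forest_weight_first_generation (R : realType) d (nu : 'I_d -> vec d -> R)
    (r : vec d) (A : gmat d) :
  \sum_(C <- gbox A) (\prod_(i < d) conv_pow (nu i) (r i) (C i)) *
     forest_weight nu (colsum C) (gsub A C) = forest_weight nu r A.
Proof.
rewrite /forest_weight; pose m := colsum A.
(* In the Leibniz expansion each term is a product over rows, and [m] does not depend on [C], so the
   sum over [C] can be taken row by row. *)
transitivity (\sum_(C <- gbox A) \sum_(s : 'S_d) (-1) ^+ s *
   \prod_(i < d) (conv_pow (nu i) (r i) (C i) *
     (conv_pow (nu i) (m i) (vsub (A i) (C i)) *
       ((i == s i)%:R - (vsub (A i) (C i) (s i))%:R / (maxn (m i) 1)%:R)))).
  rewrite !big_seq; apply: eq_bigr => C; rewrite mem_gbox => CA.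
  rewrite colsum_gsub // -/m [X in _ * X]mulrC mulrA -big_split mulr_sumr.
  apply: eq_bigr => s _; rewrite mulrCA; congr (_ * _); rewrite -big_split /=.
  by apply: eq_bigr => i _; rewrite !mxE !ffunE mulrA.
rewrite exchange_big mulr_suml; apply: eq_bigr => s _ /=.
rewrite -mulr_sumr -mulrA; congr (_ * _).
rewrite (sum_gbox_prod A (fun i a => conv_pow (nu i) (r i) a *
     (conv_pow (nu i) (m i) (vsub (A i) a) *
       ((i == s i)%:R - (vsub (A i) a (s i))%:R / (maxn (m i) 1)%:R)))).
rewrite -big_split /=.
have A0 i j : m j = 0%N -> A i j = 0%N.
  by move=> /eqP; rewrite ffunE sum_nat_eq0 => /forallP/(_ i)/eqP.
have nE i : vadd r (colsum A) i = (r i + m i)%N by rewrite ffunE.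
(* Row [i] with [m i = 0] is averaged correctly at its diagonal entry. A permutation that moves such
   an [i] contributes zero to both sides. *)
case: (boolP [forall i, (m i != 0%N) || (s i == i)]) => [/forallP ms|].
  apply: eq_bigr => i _; rewrite mxE nE [RHS]mulrC.
  have [mi|mi] := eqVneq (m i) 0%N; last exact: sum_forest_row.
  move: (ms i); rewrite mi /= => /eqP si.
  by rewrite si addn0 sum_forest_row0 (A0 _ _ mi) mul0r subr0.
case/forallPn => i; rewrite negb_or negbK => /andP[/eqP mi si].
(* Column [i] of [A] vanishes, so both products have a zero factor at [s^-1 i]. *)
have sV : s ((s^-1)%g i) = i by rewrite permKV.
have ne : ((s^-1)%g i == i) = false.
  by apply: contraNF si => /eqP e; rewrite -{1}e sV.
rewrite (bigD1 ((s^-1)%g i)) //= [RHS](bigD1 ((s^-1)%g i)) //= sV.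
rewrite mxE (A0 _ _ mi) ne mul0r subr0 !mul0r big1 ?mul0r // => c _.
have -> : vsub (A ((s^-1)%g i)) c i = 0%N by rewrite ffunE (A0 _ _ mi).
by rewrite mul0r subr0 !mulr0.
Qed.

(** The base case. If [A] is nonzero, either some type without individuals has children, and its
    factor [nu_i^{*0}] vanishes, or [n] is a nonzero left null vector of [forest_mx]. *)
Lemma forest_weight_extinct (R : realType) d (nu : 'I_d -> vec d -> R)
    (r : vec d) (A : gmat d) :
  vzero r -> forest_weight nu r A = (A == gzero d)%:R.
Proof.
move=> /forallP r0; rewrite /forest_weight.
have -> : vadd r (colsum A) = colsum A.
  by apply/ffunP => j; rewrite ffunE (eqP (r0 j)).
have [->|A0] := eqVneq A (gzero d).
  have c0 i : colsum (gzero d) i = 0%N.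
    by rewrite ffunE big1 // => ? _; rewrite !ffunE.
  rewrite [X in \det X](_ : _ = 1%:M) ?det1 ?mul1r; last first.
    by apply/matrixP => i j; rewrite !mxE !ffunE mul0r subr0.
  apply: big1 => i _; have : vzero (gzero d i) by apply/forallP => j; rewrite !ffunE.
  by rewrite !ffunE big1 ?conv_pow0 => [->//|] ? _; rewrite !ffunE.
set n := colsum A.
case: (boolP [exists i, (n i == 0%N) && ~~ vzero (A i)]).
  case/existsP => i /andP[/eqP ni Ai].
  by rewrite (bigD1 i) // ni conv_pow0 (negbTE Ai) /= mulr0n mul0r mulr0.
rewrite negb_exists => /forallP nA.
suff -> : \det (forest_mx R n A) = 0 by rewrite mul0r.
(* As [r = 0], the individuals of type [j] are all children: [n_j = \sum_i A_ij]. *)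
apply/eqP/det0P; exists (\row_i (n i)%:R).
  apply: contraNneq A0 => /rowP n0; apply/eqP/ffunP => i; apply/ffunP => j.
  have /eqP := n0 j; rewrite !mxE pnatr_eq0 !ffunE sum_nat_eq0.
  by move=> /forallP/(_ i)/eqP.
apply/rowP => j; rewrite !mxE.
under eq_bigr => i _ do rewrite !mxE mulrBr.
rewrite sumrB (bigD1 j) //= eqxx mulr1 big1 ?addr0; last first.
  by move=> i /negbTE ->; rewrite mulr0.
rewrite [X in X%:R - _]ffunE natr_sum; apply/eqP; rewrite subr_eq0; apply/eqP.
(* The weight [n i] cancels the divisor; where [n i = 0], row [i] of [A] is zero by [nA]. *)
apply: eq_bigr => i _; have [ni|ni] := eqVneq (n i) 0%N.
  have := nA i; rewrite ni /= negbK => /forallP/(_ j)/eqP ->.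
  by rewrite mul0r.
by rewrite (maxn_idPl _) ?lt0n // [RHS]mulrC divfK // pnatr_eq0.
Qed.

(** * Trajectories with given totals *)

Definition progeny d (cs : seq (gmat d)) : gmat d :=
  [ffun i => [ffun j => A_tot cs i j]].

Lemma progeny_nil d : progeny [::] = gzero d.
Proof. by apply/ffunP => i; apply/ffunP => j; rewrite !ffunE /A_tot big_ord0. Qed.

Lemma progeny_cons d (C : gmat d) cs : progeny (C :: cs) = gadd C (progeny cs).
Proof.
by apply/ffunP => i; apply/ffunP => j; rewrite !ffunE /A_tot big_ord_recl.
Qed.

(** The condition [gle C A] makes the truncated subtraction in [gsub] exact. *)
Lemma progeny_cons_eq d (C A : gmat d) cs :
  (progeny (C :: cs) == A) = gle C A && (progeny cs == gsub A C).
Proof.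
rewrite progeny_cons; apply/eqP/andP => [<-|[/gleP CA /eqP ->]].
  split; first by apply/gleP => i j; rewrite !ffunE leq_addr.
  by apply/eqP/ffunP => i; apply/ffunP => j; rewrite !ffunE addKn.
by apply/ffunP => i; apply/ffunP => j; rewrite !ffunE subnKC.
Qed.

(** Beyond [size cs] the two sides would return different defaults, [r] and [colsum C]. *)
Lemma Zt_cons d (r : vec d) C cs t :
  (t <= size cs)%N -> Zt r (C :: cs) t.+1 = Zt (colsum C) cs t.
Proof. by move=> le; rewrite /Zt /=; apply: set_nth_default; rewrite /= size_map ltnS. Qed.

Lemma extinct_path_nil d (r : vec d) : extinct_path r [::] = vzero r.
Proof.
by rewrite /extinct_path /Zt /=; case: (vzero r) => //=; apply/forallP => -[].
Qed.

Lemma extinct_path_cons d (r : vec d) C cs :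
  extinct_path r (C :: cs) = ~~ vzero r && extinct_path (colsum C) cs.
Proof.
rewrite /extinct_path /= Zt_cons // andbCA; congr (_ && _).
apply/forallP/andP => [alive|[r0 /forallP alive]].
  split; first exact: (alive ord0).
  apply/forallP => t; have := alive (lift ord0 t).
  by rewrite lift0 Zt_cons // ltnW.
case=> -[|t] lt //=; rewrite Zt_cons; last exact: ltnW.
exact: (alive (Ordinal (lt : (t < size cs)%N))).
Qed.

Lemma path_weight_cons (R : realType) d (nu : 'I_d -> vec d -> R) r C cs :
  path_weight nu r (C :: cs) =
  (\prod_(i < d) conv_pow (nu i) (r i) (C i)) * path_weight nu (colsum C) cs.
Proof.
rewrite /path_weight /= big_ord_recl; congr (_ * _).
by apply: eq_bigr => t _; rewrite lift0 Zt_cons // ltnW.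
Qed.

(** Every individual is either initial or a child of someone in the preceding generation. *)
Lemma O_totE d (r : vec d) cs j : O_tot r cs j = (r j + \sum_(i < d) A_tot cs i j)%N.
Proof.
rewrite /O_tot big_ord_recl; congr (_ + _)%N.
rewrite /A_tot exchange_big /=; apply: eq_bigr => t _.
rewrite /bump leq0n add1n /Zt /= (nth_map [ffun _ => [ffun _ => 0%N]]) //.
by rewrite ffunE.
Qed.

(* When [fuel] is at least [total_births r A], this lists the trajectories from [r] to
   extinction with totals [A]. *)
Fixpoint paths d (fuel : nat) (r : vec d) (A : gmat d) : seq (seq (gmat d)) :=
  if vzero r then nseq (A == gzero d) [::] else
  if fuel is f.+1 then
    [seq C :: cs | C <- gbox A, cs <- paths f (colsum C) (gsub A C)]
  else [::].

Lemma paths_uniq d f (r : vec d) (A : gmat d) : uniq (paths f r A).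
Proof.
elim: f r A => [|f IH] r A /=; case: (vzero r) => //; try by case: eqP.
apply: allpairs_uniq_dep; first exact: gbox_uniq.
  by move=> C _; apply: IH.
by move=> [C cs] [C' cs'] _ _ /= [-> ->].
Qed.

Definition total_births d (r : vec d) (A : gmat d) : nat :=
  (\sum_(j < d) (r j + colsum A j))%N.

(** The remaining forest has as many individuals as [A] has children, so the count drops by the
    number of initial individuals, which is positive. *)
Lemma total_births_lt d (r : vec d) (A C : gmat d) f :
  ~~ vzero r -> gle C A -> (total_births r A <= f.+1)%N ->
  (total_births (colsum C) (gsub A C) <= f)%N.
Proof.
move=> r0 CA; rewrite /total_births => le.
have -> : (\sum_(j < d) (colsum C j + colsum (gsub A C) j) = \sum_(j < d) colsum A j)%N.
  by apply: eq_bigr => j _; rewrite -(colsum_gsub CA) [RHS]ffunE.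
rewrite -ltnS; apply: leq_trans le; rewrite big_split /= -[X in (X < _)%N]add0n ltn_add2r.
case/forallPn: r0 => j rj; rewrite (bigD1 j) //= ltn_addr // lt0n //.
Qed.

Lemma total_births_gt0 d (r : vec d) (A : gmat d) :
  ~~ vzero r -> (0 < total_births r A)%N.
Proof.
by case/forallPn => j rj; rewrite /total_births (bigD1 j) //= !ltn_addr // lt0n.
Qed.

Lemma mem_paths d f (r : vec d) (A : gmat d) cs :
  (total_births r A <= f)%N ->
  (cs \in paths f r A) = extinct_path r cs && (progeny cs == A).
Proof.
elim: f r A cs => [|f IH] r A cs le /=; case: (boolP (vzero r)) => r0.
- case: cs => [|C cs]; rewrite ?extinct_path_nil ?extinct_path_cons ?r0 /=.
    by rewrite progeny_nil eq_sym; case: eqP.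
  by case: eqP.
- by move: le; rewrite leqNgt total_births_gt0.
- case: cs => [|C cs]; rewrite ?extinct_path_nil ?extinct_path_cons ?r0 /=.
    by rewrite progeny_nil eq_sym; case: eqP.
  by case: eqP.
apply/allpairsPdep/idP => [[C [cs' [CA cs'P ->]]]|].
  rewrite mem_gbox in CA; rewrite extinct_path_cons r0 progeny_cons_eq CA /=.
  by rewrite -IH // (total_births_lt r0 CA le).
case: cs => [|C cs]; first by rewrite extinct_path_nil (negbTE r0).
rewrite extinct_path_cons progeny_cons_eq => /andP[/andP[_ ep] /andP[CA pr]].
exists C, cs; rewrite mem_gbox; split=> //.
by rewrite IH ?ep // (total_births_lt r0 CA le).
Qed.

(** Both sides obey the same recursion on the first generation, with the same value at
    extinction. *)
Lemma sum_paths (R : realType) d (nu : 'I_d -> vec d -> R) f r A :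
  (total_births r A <= f)%N ->
  \sum_(cs <- paths f r A) path_weight nu r cs = forest_weight nu r A.
Proof.
elim: f r A => [|f IH] r A le /=; case: (boolP (vzero r)) => r0.
- rewrite forest_weight_extinct //; case: eqP => _ /=; rewrite ?big_nil //.
  by rewrite big_seq1 /path_weight big_ord0.
- by move: le; rewrite leqNgt total_births_gt0.
- rewrite forest_weight_extinct //; case: eqP => _ /=; rewrite ?big_nil //.
  by rewrite big_seq1 /path_weight big_ord0.
rewrite big_allpairs_dep -forest_weight_first_generation !big_seq.
apply: eq_bigr => C; rewrite mem_gbox => CA.
rewrite -IH ?(total_births_lt r0 CA le) // big_distrr /=.
by apply: eq_bigr => cs _; rewrite path_weight_cons.
Qed.

Lemma conv_pow_ge0 (R : numDomainType) d (nu : vec d -> R) m k :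
  (forall z, 0 <= nu z) -> 0 <= conv_pow nu m k.
Proof.
move=> nu0; elim: m k => [|m IH] k; first by rewrite conv_pow0 ler0n.
by rewrite conv_powS; apply: sumr_ge0 => a _; apply: mulr_ge0.
Qed.

Lemma path_weight_ge0 (R : realType) d (nu : 'I_d -> vec d -> R) r cs :
  (forall i z, 0 <= nu i z) -> 0 <= path_weight nu r cs.
Proof.
by move=> nu0; apply: prodr_ge0 => t _; apply: prodr_ge0 => i _; apply: conv_pow_ge0.
Qed.

(** Fixed totals leave finitely many trajectories, listed once each by [paths], so the extended sum
    is a finite one. *)
Lemma esum_paths (R : realType) d (nu : 'I_d -> vec d -> R) r A :
  (forall i z, 0 <= nu i z) ->
  \esum_(cs in [set cs | extinct_path r cs && (progeny cs == A)])
    (path_weight nu r cs)%:E = (forest_weight nu r A)%:E.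
Proof.
move=> nu0; pose s := paths (total_births r A) r A.
have -> : [set cs | extinct_path r cs && (progeny cs == A)]%classic = [set` s]%classic.
  by apply/seteqP; split => cs /=; rewrite mem_paths.
rewrite esum_fset; [|exact: finite_seq|by move=> cs _; rewrite lee_fin path_weight_ge0].
rewrite -fsbig_seq ?paths_uniq // sumEFin; congr (_%:E); exact: sum_paths.
Qed.

(** * Translation of the integer data into a progeny matrix *)

(** The totals [n] fix the diagonal: [n_j] is [r_j] plus column [j] of the progeny, and the
    off-diagonal part together with [r_j] is [-k_jj], which leaves [n_j + k_jj]. *)
Lemma event_progenyE d (r n : 'I_d -> int) (k : 'I_d -> 'I_d -> int) (A : gmat d)
    (cs : seq (gmat d)) :
  (forall i, 0 <= r i) ->
  (forall j, - k j j = r j + \sum_(i < d | i != j) k i j) ->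
  (forall i j, (A i j)%:Z = (if j == i then n i + k i i else k i j)) ->
  ((forall j, (O_tot [ffun i => absz (r i)] cs j)%:Z = n j) /\
   (forall i j, i != j -> (A_tot cs i j)%:Z = k i j)) <-> progeny cs = A.
Proof.
move=> r0 kE AE.
have OE j : (O_tot [ffun i => absz (r i)] cs j)%:Z =
    r j + ((A_tot cs j j)%:Z + \sum_(i < d | i != j) (A_tot cs i j)%:Z).
  by rewrite O_totE ffunE PoszD gez0_abs // (bigD1 j) //= PoszD (big_morph Posz PoszD (erefl _)).
pose S j := \sum_(i < d | i != j) k i j.
have kE' j : - k j j = r j + S j := kE j.
split=> [[On Ak]|pA].
  apply/ffunP => i; apply/ffunP => j; rewrite !ffunE.
  apply/eqP; rewrite -eqz_nat AE; apply/eqP.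
  have [->|ji] := eqVneq j i; last by rewrite Ak // eq_sym.
  have nE : n i = r i + ((A_tot cs i i)%:Z + S i).
    by rewrite -On OE; congr (_ + (_ + _)); apply: eq_bigr => l; apply: Ak.
  by have := kE' i; lia.
have Ak i j : (A_tot cs i j)%:Z = if j == i then n i + k i i else k i j.
  by rewrite -AE -pA !ffunE.
split=> [j|i j ij]; last by rewrite Ak eq_sym (negbTE ij).
rewrite OE Ak eqxx.
rewrite (eq_bigr (k^~ j)) => [|i ij]; last by rewrite Ak eq_sym (negbTE ij).
by have := kE' j; rewrite -/(S j); lia.
Qed.

Lemma det_forest_mx (R : realType) d (n : 'I_d -> int) (k : 'I_d -> 'I_d -> int)
    (A : gmat d) :
  (forall i, 0 <= n i) ->
  (forall i j, (A i j)%:Z = (if j == i then n i + k i i else k i j)) ->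
  (forall i j, n j = 0 -> A i j = 0%N) ->
  \det (forest_mx R [ffun i => absz (n i)] A) =
  (detK n k)%:~R / \prod_(i < d) (Num.max (n i) 1)%:~R.
Proof.
move=> n0 AE A0.
(* [N] is [forest_mx] with its rows cleared of denominators. Where [n i = 0] column [i] is a unit
   vector; on the other indices the entries are [- k i j], since [n i - A i i = - k i i]. *)
pose N : 'M[int]_d := \matrix_(i, j) ((i == j)%:R * Num.max (n i) 1 - (A i j)%:Z).
pose S := [set i : 'I_d | n i != 0]%classic.
have SE i : in_set S i = (n i != 0) by apply: asboolb.
have maxS i : in_set S i -> Num.max (n i) 1 = n i.
  by rewrite SE => ni; apply/max_idPl; have := n0 i; lia.
have -> : detK n k = \det N.
  rewrite (det_minor_unit_cols (A := in_set S)) => [|i j].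
    congr (\det _); apply/matrixP => a b; rewrite !mxE AE.
    have aS : in_set S (enum_val a) := enum_valP a.
    rewrite !(inj_eq enum_val_inj) (maxS _ aS).
    have [<-|ab] := eqVneq b a; first by rewrite mul1r opprD addrA subrr sub0r.
    by rewrite mul0r sub0r.
  rewrite -[i \notin _]/(~~ in_set S i) SE negbK => /eqP ni.
  by rewrite !mxE (A0 _ _ ni) subr0; case: (eqVneq j i) => [->|_]; rewrite ?mul0r ?ni.
have maxR i : (Num.max (n i) 1)%:~R = (maxn `|n i|%N 1)%:R :> R.
  by rewrite pmulrn; congr (_%:~R); have := n0 i; lia.
have max0 i : (Num.max (n i) 1)%:~R != 0 :> R by rewrite maxR pnatr_eq0; lia.
apply: (canRL (mulfK _)); first by apply/prodf_neq0.
pose D : 'rV[R]_d := \row_i (Num.max (n i) 1)%:~R.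
have -> : \prod_(i < d) (Num.max (n i) 1)%:~R = \det (diag_mx D).
  by rewrite det_diag; apply: eq_bigr => i _; rewrite mxE.
rewrite mulrC -det_mulmx -det_map_mx; congr (\det _).
apply/matrixP => i j; rewrite mul_diag_mx !mxE ffunE -maxR.
by rewrite rmorphB rmorphM /= mulrBr [X in _ - X]mulrC divfK // mulrC -pmulrn;
  case: (i == j); rewrite ?mulr0 ?mulr1.
Qed.

Theorem theorem1p2 (R : realType) (d : nat) (nu : 'I_d -> vec d -> R)
  (r n : 'I_d -> int) (k : 'I_d -> 'I_d -> int) :
  (2 <= d)%N ->
  (forall i, is_prob_vec (nu i)) ->
  finite_means nu ->
  irreducible_mx (mean_matrix nu) ->
  ~ degenerate nu ->
  spectral_radius_le1 (mean_matrix nu) ->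
  (forall i, 0 <= r i) ->
  1 <= \sum_(i < d) r i ->
  (forall i j, i != j -> 0 <= k i j) ->
  (forall j, - k j j = r j + \sum_(i < d | i != j) k i j) ->
  (forall i, - k i i <= n i) ->
  prob_OA nu [ffun i => absz (r i)] n k =
  ((detK n k)%:~R / \prod_(i < d) (Num.max (n i) 1)%:~R *
   \prod_(i < d) conv_pow (nu i) (absz (n i))
       [ffun j => if j == i then absz (n i + k i i) else absz (k i j)])%:E.
Proof.
move=> _ nu_prob _ _ _ _ r0 _ k0 kE kn.
have nu0 i z : 0 <= nu i z by have [] := nu_prob i.
pose S j := \sum_(i < d | i != j) k i j.
have kE' j : - k j j = r j + S j := kE j.
have S0 j : 0 <= S j by apply: sumr_ge0 => i; apply: k0.
have n0 i : 0 <= n i.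
  by have := kn i; have := kE' i; have := S0 i; have := r0 i; lia.
(* The only progeny matrix compatible with the event; its rows are the arguments of [conv_pow] in
   the formula. *)
pose A : gmat d := [ffun i => [ffun j =>
  if j == i then absz (n i + k i i) else absz (k i j)]].
have AE i j : (A i j)%:Z = if j == i then n i + k i i else k i j.
  rewrite !ffunE; have [_|ji] := eqVneq j i; rewrite gez0_abs //.
    by have := kn i; lia.
  by apply: k0; rewrite eq_sym.
have nE : vadd [ffun i => absz (r i)] (colsum A) = [ffun i => absz (n i)].
  apply/ffunP => j; apply/eqP; rewrite !ffunE -eqz_nat PoszD !gez0_abs //.
  rewrite (big_morph Posz PoszD (erefl _)) (bigD1 j) //= AE eqxx.
  rewrite (eq_bigr (k^~ j)) => [|i ij]; last by rewrite AE eq_sym (negbTE ij).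
  by have := kE' j; rewrite -/(S j); lia.
have A0 i j : n j = 0 -> A i j = 0%N.
  move=> nj; have /ffunP/(_ j)/eqP := nE.
  rewrite [X in X == _]ffunE [X in _ == X]ffunE nj addn_eq0 => /andP[_].
  by rewrite [colsum A j]ffunE sum_nat_eq0 => /forallP/(_ i)/eqP.
rewrite /prob_OA [X in esum X _](_ : _ =
    [set cs | extinct_path [ffun i => absz (r i)] cs && (progeny cs == A)]%classic).
  rewrite esum_paths // /forest_weight nE (det_forest_mx _ n0 AE A0).
  by congr (_ * _)%:E; apply: eq_bigr => i _; rewrite !ffunE.
apply/seteqP; split => cs /=.
  by case=> -> On Ak /=; apply/eqP/(event_progenyE cs r0 kE AE).
by case/andP => ep /eqP /(event_progenyE cs r0 kE AE)[].
Qed.
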